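(* $$\dim_H \left\{ x \in \mathbb{I} : (d_n(x))^{1/n} \not\to e \text{ as } n \to \infty \right\} = 1,$$ where $\mathbb{I}$ is the set of irrational numbers in $(0,1]$.
   Context: Pierce expansion digits: for $x \in (0,1]$ put $d_1(x) := \lfloor 1/x \rfloor$ and $T(x) := 1 - d_1(x)x$, and for $k \in \mathbb{N}$ put $d_k(x) := d_1(T^{k-1}(x))$ provided $T^{k-1}(x) \neq 0$. All digits $d_k(x)$, $k \in \mathbb{N}=\{1,2,\dots\}$, are defined exactly when $x$ is irrational, and then they form a strictly increasing sequence of positive integers. $\dim_H$ is the Hausdorff dimension. *)

(* Defs.v *)
From HB Require Import structures.
From mathcomp Require Import all_boot all_order all_algebra.
From mathcomp Require Import boolp classical_sets functions cardinality.
From mathcomp Require Import reals ereal topology normedtype sequences exp.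

Set Implicit Arguments.
Unset Strict Implicit.
Unset Printing Implicit Defensive.

Import Order.TTheory GRing.Theory Num.Theory.
Import numFieldNormedType.Exports.

Local Open Scope classical_set_scope.
Local Open Scope ring_scope.

Section Hausdorff.
Context {R : realType}.
Local Open Scope ereal_scope.

(* diam set0 = -oo *)
Definition diam (A : set R) : \bar R :=
  ereal_sup [set r | exists x y, [/\ A x, A y & r = `|x - y|%R%:E]].

(* |A|^s, with the usual convention that the empty set weighs 0, also for
   s = 0; for nonempty A, [poweR] gives 0 `^ 0 = 1 and +oo `^ 0 = 1. *)
Definition diam_pow (s : R) (A : set R) : \bar R :=
  if A == set0 then 0 else diam A `^ s.

Definition delta_cover (delta : R) (E : set R) (U : (set R)^nat) : Prop :=
  E `<=` \bigcup_i U i /\ forall i, diam (U i) <= delta%:E.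

Definition hausdorff_premeasure (s delta : R) (E : set R) : \bar R :=
  ereal_inf [set \sum_(0 <= i <oo) diam_pow s (U i) |
             U in [set U | delta_cover delta E U]].

(* The premeasure increases as delta decreases, so this supremum is its limit
   as delta tends to 0 from the right. *)
Definition hausdorff_measure (s : R) (E : set R) : \bar R :=
  ereal_sup [set hausdorff_premeasure s delta E |
             delta in [set delta : R | (0 < delta)%R]].

Definition hausdorff_dim (E : set R) : \bar R :=
  ereal_inf [set s%:E |
             s in [set s : R | (0 <= s)%R /\ hausdorff_measure s E = 0]].

End Hausdorff.

Section Pierce.
Context {R : realType}.

Definition pierce_d1 (x : R) : int := Num.floor (1 / x).

Definition pierce_T (x : R) : R := 1 - (pierce_d1 x)%:~R * x.

(* Digits are numbered from k = 1. They are meaningful as long as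
   T^{k-1} x != 0, hence for all k >= 1 when x in ]0, 1] is irrational; the
   values at k = 0 and after the orbit has reached 0 are junk. *)
Definition pierce_digit (k : nat) (x : R) : int :=
  pierce_d1 (iter k.-1 pierce_T x).

End Pierce.

(* Main.v *)
Require Import Defs.
From HB Require Import structures.
From mathcomp Require Import all_boot all_order all_algebra.
From mathcomp Require Import boolp classical_sets functions cardinality.
From mathcomp Require Import reals ereal topology normedtype sequences exp.
From mathcomp Require Import measure lebesgue_measure ring lra.

Set Implicit Arguments.
Unset Strict Implicit.
Unset Printing Implicit Defensive.

Import Order.TTheory GRing.Theory Num.Theory.
Import numFieldNormedType.Exports.

Local Open Scope classical_set_scope.
Local Open Scope ring_scope.

(** The upper bound holds for every subset of ]0, 1]: cutting it into N intervals
of length 1/N shows that its s-dimensional measure vanishes as soon as s > 1.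

For the lower bound it is enough to consider the points x whose digits satisfy
d_{n+1} >= 4 (d_n + 1) for all n, since then d_n >= 4^n and d_n^{1/n} >= 4 > e
for all n.  Imposing this condition keeps only one quarter of each cylinder at
each level, but the cylinders shrink super-exponentially, so that the loss
does not affect the dimension.

This is made precise without constructing a measure.  Every irrational v of
]0, 1[ has an expansion
   v = 4 / k_1 - 4^2 / (k_1 k_2) + 4^3 / (k_1 k_2 k_3) - ...
whose digits are produced by k = d_1 (v / 4) and whose shift is v |-> T (v / 4);
its digits automatically satisfy k_{n+1} >= 4 (k_n + 1).  The map [respread] that
sends v to the number
   x = 1 / k_1 - 1 / (k_1 k_2) + 1 / (k_1 k_2 k_3) - ...
with Pierce digits k_1, k_2, ... semiconjugates the shift to T
([respread_T]), so it takes its values in the set of interest.  Its inverse is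
Hoelder of exponent s for each s < 1, on the v small enough
([respread_holder]): prepending a common digit k multiplies |v - w| by
4 / k and |x - y|^s by k^{-s}, and 4 / k <= k^{-s} once k is large.
Consequently a cover of the image by sets U_i yields a cover of a set of positive
Lebesgue measure by intervals of length comparable to |U_i|^s, whence a positive
Hausdorff measure ([hausdorff_measure_neq0]). *)

(** * Pierce digits *)

Section pierce_basics.
Context {R : realType}.
Implicit Types x : R.

Lemma pierce_d1_bounds x : 0 < x ->
  ((pierce_d1 x)%:~R * x <= 1) /\ (1 < ((pierce_d1 x)%:~R + 1) * x).
Proof.
move=> x0; rewrite /pierce_d1; split.
  by rewrite -ler_pdivlMr// floor_le.
by rewrite -ltr_pdivrMr// -[X in _ + X]/(1%:~R) -intrD floorD1_gt.
Qed.

Lemma pierce_d1_eq (k : int) x : 0 < x -> k%:~R * x <= 1 ->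
  1 < (k%:~R + 1) * x -> pierce_d1 x = k.
Proof.
move=> x0 h1 h2; apply: floor_def.
by rewrite ler_pdivlMr// h1 /= ltr_pdivrMr// intrD.
Qed.

Lemma pierce_T_ge0 x : 0 < x -> 0 <= pierce_T x.
Proof. by move=> /pierce_d1_bounds[h _]; rewrite /pierce_T subr_ge0. Qed.

Lemma pierce_T_lt x : 0 < x -> pierce_T x < x.
Proof. by move=> /pierce_d1_bounds[_ h]; rewrite /pierce_T; lra. Qed.

(** If x = p / q then T x = p' / q with p' = q - d_1 p < p, so the numerators
decrease strictly until the orbit reaches 0. *)
Lemma rational_pierce_T_iter x : 0 < x -> rational x ->
  exists n, iter n pierce_T x = 0.
Proof.
move=> x0 [r _ rx].
have [p [q [q0 xqp]]] : exists (p : nat) (q : int), 0 < q /\ x * q%:~R = p%:R.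
  exists `|numq r|%N, (denq r); split; first exact: denq_gt0.
  rewrite natr_absz ger0_norm ?numq_ge0; last by rewrite -(ler0q R) rx ltW.
  by rewrite -rx /ratr divfK// intr_eq0 denq_neq0.
elim/ltn_ind: p x x0 xqp {rx r} => p IH x x0 xqp.
have := pierce_T_ge0 x0; rewrite le_eqVlt => /predU1P[Tx0|Tx0].
  by exists 1%N.
pose p' : int := q - pierce_d1 x * p%:Z.
have TxqE : pierce_T x * q%:~R = p'%:~R.
  by rewrite /p' rmorphB rmorphM/= -[(p%:Z)%:~R]/(p%:R) -xqp /pierce_T; ring.
have qR0 : 0 < q%:~R :> R by rewrite ltr0z.
have p'E : `|p'|%N%:R = p'%:~R :> R.
  by rewrite natr_absz ger0_norm// -(ler0z R) -TxqE mulr_ge0// ltW.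
have [n Hn] : exists n, iter n pierce_T (pierce_T x) = 0.
  apply: (IH `|p'|%N) => //; last by rewrite p'E TxqE.
  by rewrite -(ltr_nat R) p'E -TxqE -xqp ltr_pM2r// pierce_T_lt.
by exists n.+1; rewrite iterSr.
Qed.

End pierce_basics.

(** * Expansions with digits growing at least fourfold *)

Section sparse.
Context {R : realType}.
Implicit Types v w : R.

Definition unit_irrat : set R := [set v | 0 < v < 1 /\ irrational v].

Definition sparse_digit v : int := pierce_d1 (v / 4).
Definition sparse_shift v : R := pierce_T (v / 4).

Local Notation K v := ((sparse_digit v)%:~R : R).
Local Notation S := sparse_shift.

Lemma sparse_shiftE v : S v = 1 - K v * v / 4.
Proof. by rewrite /sparse_shift /pierce_T mulrA. Qed.

Lemma sparse_digit_bounds v : 0 < v -> K v * v <= 4 /\ 4 < (K v + 1) * v.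
Proof.
move=> v0; have [] := @pierce_d1_bounds R (v / 4); first lra.
rewrite -/(sparse_digit v) => h1 h2.
by move: h1 h2; set k := _%:~R => h1 h2; split; nra.
Qed.

Lemma sparse_digit_ge (m : int) v : 0 < v -> m%:~R * v <= 4 ->
  m <= sparse_digit v.
Proof.
move=> v0 h; rewrite /sparse_digit /pierce_d1 floor_ge_int.
rewrite ler_pdivlMr; lra.
Qed.

Lemma sparse_digit_ge4 v : unit_irrat v -> 4 <= K v.
Proof.
move=> [/andP[v0 v1] _]; rewrite -[leLHS]/(4%:~R) ler_int.
by apply: sparse_digit_ge => //; rewrite -[_%:~R]/(4 : R); lra.
Qed.

Lemma unit_irrat_shift v : unit_irrat v -> unit_irrat (S v).
Proof.
move=> Dv; have k4 := sparse_digit_ge4 Dv; case: Dv => /andP[v0 v1] vi.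
have [h1 h2] := sparse_digit_bounds v0.
have Si : irrational (S v).
  move=> [r _ rE]; apply: vi; exists ((1 - r) * 4 / (sparse_digit v)%:~R) => //.
  rewrite fmorph_div rmorphM rmorphB rmorph_int rmorph1 rmorph_nat/= rE sparse_shiftE.
  by field; lra.
split => //; rewrite lt_neqAle; apply/andP; split; last first.
  by rewrite sparse_shiftE; nra.
rewrite sparse_shiftE.
rewrite subr_ge0 ler_pdivrMr// mul1r h1 andbT.
apply/eqP => S0; apply: Si; exists 0 => //.
by rewrite rmorph0 S0 sparse_shiftE.
Qed.

Lemma sparse_shift_lt v : unit_irrat v -> (K v + 1) * S v < 1.
Proof.
move=> Dv; have k4 := sparse_digit_ge4 Dv; case: Dv => /andP[v0 _] _.
have [h1 h2] := sparse_digit_bounds v0.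
rewrite sparse_shiftE.
by move: k4 h1 h2; set k := _%:~R => k4 h1 h2; nra.
Qed.

(** Since v / 4 lies above 1 / (k + 1), its image under T is below 1 / (k + 1); the
next digit is computed from a quarter of that. *)
Lemma sparse_digit_shift v : unit_irrat v -> 4 * (K v + 1) <= K (S v).
Proof.
move=> Dv; have [/andP[Sv0 Sv1] _] := unit_irrat_shift Dv.
have [/andP[v0 _] _] := Dv.
have -> : 4 * (K v + 1) = (4 * (sparse_digit v + 1))%:~R :> R.
  by rewrite intrM intrD.
rewrite ler_int; apply: sparse_digit_ge => //.
rewrite intrM intrD; have := sparse_shift_lt Dv.
rewrite -[4%:~R]/(4 : R) -[1%:~R]/(1 : R); lra.
Qed.

(** The n-th partial sum of 1 / k_1 - 1 / (k_1 k_2) + ..., written in nested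
form so that the shift acts on it. *)
Fixpoint respread_approx n v : R :=
  if n is m.+1 then (1 - respread_approx m (S v)) / K v else 0.

Lemma respread_approx_itv n v : unit_irrat v -> 0 <= respread_approx n v <= 1.
Proof.
elim: n v => [|n IH] v Dv /=; first by rewrite lexx ler01.
have /andP[h1 h2] := IH _ (unit_irrat_shift Dv).
have k4 := sparse_digit_ge4 Dv.
rewrite divr_ge0/=; [|lra|lra].
by rewrite ler_pdivrMr; lra.
Qed.

Lemma respread_approx_step n v : unit_irrat v ->
  `|respread_approx n.+1 v - respread_approx n v| <= 4^-1 ^+ n.
Proof.
elim: n v => [|n IH] v Dv.
  rewrite subr0 expr0 ger0_norm; by have /andP[] := respread_approx_itv 1 Dv.
have k4 := sparse_digit_ge4 Dv.
have := IH _ (unit_irrat_shift Dv).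
have -> : respread_approx n.+2 v - respread_approx n.+1 v =
  - ((respread_approx n.+1 (S v) - respread_approx n (S v)) / K v).
  by rewrite [X in X - _]/= [X in _ - X]/= -/(respread_approx n.+1 (S v)); field; lra.
rewrite normrN normrM normfV => h.
rewrite exprSr; apply: ler_pM => //.
by rewrite lef_pV2 ?posrE ?ger0_norm//; lra.
Qed.

Definition respread v : R := limn (fun n => respread_approx n v).

Lemma respread_cvg v : unit_irrat v ->
  respread_approx n v @[n --> \oo] --> respread v.
Proof.
move=> Dv; set u := fun n => respread_approx n v.
have uE : u = series (telescope u).
  by rewrite telescopeK; apply/funext => n; rewrite /= /u /= subr0.
suff : cvgn u by [].
rewrite uE; apply: normed_cvg.
apply: (@series_le_cvg _ _ (geometric 1 4^-1)).
- by move=> n; exact: normr_ge0.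
- by move=> n; rewrite /geometric /= mul1r exprn_ge0.
- by move=> n /=; rewrite mul1r; exact: respread_approx_step.
- by apply: is_cvg_geometric_series; rewrite ger0_norm; lra.
Qed.

Lemma respread_itv v : unit_irrat v -> 0 <= respread v <= 1.
Proof.
move=> Dv; have cv := respread_cvg Dv.
apply/andP; split.
  apply: (limr_ge cv); near=> n.
  by have /andP[] := respread_approx_itv n Dv.
apply: (limr_le cv); near=> n.
by have /andP[] := respread_approx_itv n Dv.
Unshelve. all: by end_near. Qed.

Lemma respreadE v : unit_irrat v -> respread v = (1 - respread (S v)) / K v.
Proof.
move=> Dv; have := respread_cvg Dv; rewrite -(cvg_shiftS (respread_approx ^~ v)).
move=> /cvg_unique; apply => //; apply: cvgMl; apply: cvgB; first exact: cvg_cst.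
exact/respread_cvg/unit_irrat_shift.
Qed.

Lemma respread_gt0 v : unit_irrat v -> 0 < respread v.
Proof.
move=> Dv; have Dv1 := unit_irrat_shift Dv.
have k4 := sparse_digit_ge4 Dv; have k14 := sparse_digit_ge4 Dv1.
have /andP[g20 _] := respread_itv (unit_irrat_shift Dv1).
rewrite respreadE// divr_gt0 ?subr_gt0//; last lra.
by rewrite respreadE// ltr_pdivrMr; lra.
Qed.

(** The tail 1 - k x has all its digits at least 4 (k + 1), so it is at most the
inverse of that.  This bound is sharper than the 1 / (k + 1) which the digit k
alone gives, and the excess is what creates the gaps of [respread_gap]. *)
Lemma respread_bounds v : unit_irrat v ->
  1 - (4 * (K v + 1))^-1 <= K v * respread v < 1.
Proof.
move=> Dv; have Dv1 := unit_irrat_shift Dv.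
have k4 := sparse_digit_ge4 Dv.
have /andP[g20 _] := respread_itv (unit_irrat_shift Dv1).
have -> : K v * respread v = 1 - respread (S v).
  by rewrite respreadE// mulrC divfK//; lra.
rewrite ltrBlDr ltrDl respread_gt0// andbT lerB//.
have k14 := sparse_digit_shift Dv.
rewrite respreadE// -[leRHS]mul1r ler_pM ?invr_ge0//; [|lra..|].
- have := respread_itv (unit_irrat_shift Dv1); lra.
- by rewrite lef_pV2// posrE; lra.
Qed.

Lemma respread_digit1 v : unit_irrat v ->
  pierce_d1 (respread v) = sparse_digit v.
Proof.
move=> Dv; have k4 := sparse_digit_ge4 Dv.
have /andP[b1 b2] := respread_bounds Dv.
apply: pierce_d1_eq; [exact: respread_gt0|exact: ltW|].
rewrite -ltr_pdivrMl; last lra.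
rewrite mulr1 -(ltr_pM2l (_ : 0 < K v)); last lra.
apply: lt_le_trans b1; rewrite -subr_gt0.
have -> : 1 - (4 * (K v + 1))^-1 - K v / (K v + 1) = 3 / 4 / (K v + 1).
  by field; lra.
by rewrite divr_gt0//; lra.
Qed.

Lemma respread_T v : unit_irrat v -> pierce_T (respread v) = respread (S v).
Proof.
move=> Dv; have k4 := sparse_digit_ge4 Dv.
rewrite /pierce_T respread_digit1// respreadE//.
by field; lra.
Qed.

Lemma unit_irrat_iter n v : unit_irrat v -> unit_irrat (iter n S v).
Proof. by move=> Dv; elim: n => //= n; exact: unit_irrat_shift. Qed.

Lemma respread_iter n v : unit_irrat v ->
  iter n pierce_T (respread v) = respread (iter n S v).
Proof.
move=> Dv; elim: n => //= n ->.
by rewrite respread_T//; exact: unit_irrat_iter.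
Qed.

(** The orbit of [respread v] under T consists of values of [respread], which never
vanish. *)
Lemma respread_irrational v : unit_irrat v -> irrational (respread v).
Proof.
move=> Dv /(rational_pierce_T_iter (respread_gt0 Dv))[n].
rewrite respread_iter// => h.
by have := respread_gt0 (unit_irrat_iter n Dv); rewrite h ltxx.
Qed.

Lemma respread_digit_ge n v : unit_irrat v ->
  4 ^+ n.+1 <= (pierce_digit n.+1 (respread v))%:~R :> R.
Proof.
move=> Dv; rewrite /pierce_digit /= respread_iter//.
rewrite respread_digit1; last exact: unit_irrat_iter.
elim: n => [|n IH]; first exact: sparse_digit_ge4.
have := sparse_digit_shift (unit_irrat_iter n Dv).
by rewrite exprS /= => h; lra.
Qed.

(** For first digits k < l, the points v, w belong to the intervals
]4 / (k + 1), 4 / k] and ]4 / (l + 1), 4 / l], so |v - w| is at most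
8 (1 / k - 1 / l).  The images x, y are at distance at least 3/4 (1 / k - 1 / l),
because x stays in the upper quarter of ]1 / (k + 1), 1 / k[.  The ratio 32 / 3
is rounded up to 11. *)
Lemma respread_gap v w : unit_irrat v -> unit_irrat w ->
  sparse_digit v < sparse_digit w ->
  `|v - w| <= 11 * `|respread v - respread w|.
Proof.
move=> Dv Dw kvw.
have kvw1 : K v + 1 <= K w.
  by rewrite -[1]/(1%:~R) -intrD ler_int lezD1.
have k4 := sparse_digit_ge4 Dv.
have /andP[bv1 bv2] := respread_bounds Dv.
have /andP[bw1 bw2] := respread_bounds Dw.
have [av1 av2] : K v * v <= 4 /\ 4 < (K v + 1) * v.
  by apply: sparse_digit_bounds; case: Dv => /andP[].
have [aw1 aw2] : K w * w <= 4 /\ 4 < (K w + 1) * w.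
  by apply: sparse_digit_bounds; case: Dw => /andP[].
move: kvw1 k4 bv1 bv2 bw1 bw2 av1 av2 aw1 aw2.
move: (K v) (K w) (respread v) (respread w) => k l x y kl k4 x1 x2 y1 y2 v1 v2 w1 w2.
pose d := k^-1 - l^-1.
have kn0 : k != 0 by rewrite gt_eqF; lra.
have ln0 : l != 0 by rewrite gt_eqF; lra.
have k1n0 : k + 1 != 0 by rewrite gt_eqF; lra.
have l1n0 : l + 1 != 0 by rewrite gt_eqF; lra.
have dE : d = (l - k) / (k * l) by rewrite /d; field; rewrite ?kn0 ?ln0 ?k1n0 ?l1n0.
have d0 : 0 < d by rewrite dE divr_gt0 ?mulr_gt0//; lra.
have xy : 3 / 4 * d <= x - y.
  have hx : k^-1 - (4 * (k * (k + 1)))^-1 <= x.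
    rewrite -(ler_pM2l (_ : 0 < k)); last lra.
    apply: le_trans x1; rewrite le_eqVlt; apply/orP; left; apply/eqP.
    by field; rewrite kn0 k1n0.
  have hy : y <= l^-1.
    by rewrite -[leRHS]mul1r ler_pdivlMr; lra.
  have hk : (k * (k + 1))^-1 <= d.
    have -> : (k * (k + 1))^-1 = k^-1 - (k + 1)^-1 by field; rewrite ?kn0 ?ln0 ?k1n0 ?l1n0.
    by rewrite /d lerB// lef_pV2// posrE; lra.
  move: hx; rewrite invfM; rewrite /d in hk *; lra.
have vw : `|v - w| <= 8 * d.
  have hv1 : v <= 4 * k^-1 by rewrite ler_pdivlMr; lra.
  have hw1 : w <= 4 * l^-1 by rewrite ler_pdivlMr; lra.
  have hv2 : 4 * (k + 1)^-1 <= v by rewrite ler_pdivrMr; lra.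
  have hw2 : 4 * (l + 1)^-1 <= w by rewrite ler_pdivrMr; lra.
  have hl : l^-1 - (l + 1)^-1 <= d.
    have -> : l^-1 - (l + 1)^-1 = (l * (l + 1))^-1 by field; rewrite ?kn0 ?ln0 ?k1n0 ?l1n0.
    rewrite dE -[leLHS]mul1r ler_pM ?invr_ge0 ?mulr_ge0//; try lra.
    by rewrite lef_pV2 ?posrE ?mulr_gt0//; nra.
  have hkl : l^-1 <= (k + 1)^-1 by rewrite lef_pV2// posrE; lra.
  rewrite ger0_norm; rewrite /d in hl *; lra.
apply: (le_trans vw); rewrite ger0_norm; lra.
Qed.

(** The Hoelder bound is propagated along the common digits of v and w.  The
error 2^-n allows an induction on n that does not look for the first digit
where v and w differ: it starts from the trivial bound |v - w| <= 1, and a common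
digit at least 8 halves the error, while 4 * k `^ s <= k keeps the constant 11. *)
Lemma respread_holder (s m v w : R) : 0 <= s <= 1 -> 8 <= m ->
  (forall k, m <= k -> 4 * k `^ s <= k) ->
  unit_irrat v -> unit_irrat w -> m <= K v -> m <= K w ->
  `|v - w| <= 11 * `|respread v - respread w| `^ s.
Proof.
move=> /andP[s0 s1] m8 hm Dv Dw mv mw.
suff H (n : nat) : forall v w, unit_irrat v -> unit_irrat w ->
    m <= K v -> m <= K w ->
    `|v - w| <= 11 * `|respread v - respread w| `^ s + 2^-1 ^+ n.
  apply/ler_addgt0Pr => e e0.
  have [n ne] : exists n, 2^-1 ^+ n <= e.
    have : (2^-1 : R) ^+ n @[n --> \oo] --> 0 by apply: cvg_expr; rewrite ger0_norm; lra.
    move=> /cvgrPdist_le/(_ _ e0)[n _ /(_ n (leqnn _))].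
    by rewrite /= sub0r normrN ger0_norm ?exprn_ge0//; exists n.
  by apply: le_trans (H n _ _ Dv Dw mv mw) _; rewrite lerD2l.
elim: n {v w Dv Dw mv mw} => [|n IH] v w Dv Dw mv mw.
  rewrite expr0; have [/andP[v0 v1] _] := Dv; have [/andP[w0 w1] _] := Dw.
  have : 0 <= `|respread v - respread w| `^ s by exact: powR_ge0.
  have : `|v - w| <= 1 by rewrite ler_norml; lra.
  lra.
have gap : forall v w, unit_irrat v -> unit_irrat w -> sparse_digit v < sparse_digit w ->
    `|v - w| <= 11 * `|respread v - respread w| `^ s + 2^-1 ^+ n.+1.
  move=> {v w Dv Dw mv mw} v w Dv Dw vw.
  have h := respread_gap Dv Dw vw.
  have p0 : 0 <= (2^-1 : R) ^+ n.+1 by rewrite exprn_ge0.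
  have : `|respread v - respread w| <= `|respread v - respread w| `^ s.
    have [->|nz] := eqVneq (respread v - respread w) 0.
      by rewrite normr0 powR_ge0.
    apply: ger1_powR => //; rewrite normr_gt0 nz /=.
    have /andP[? ?] := respread_itv Dv; have /andP[? ?] := respread_itv Dw.
    by rewrite ler_norml; lra.
  lra.
have [vw|wv|e] := ltgtP (sparse_digit v) (sparse_digit w).
- exact: gap.
- by rewrite distrC (distrC (respread v)); exact: gap.
have Dv' := unit_irrat_shift Dv; have Dw' := unit_irrat_shift Dw.
have k4 := sparse_digit_ge4 Dv.
have mv' : m <= K (S v) by have := sparse_digit_shift Dv; lra.
have mw' : m <= K (S w).
  by have := sparse_digit_shift Dw; have := sparse_digit_ge4 Dw; lra.
have := IH _ _ Dv' Dw' mv' mw'.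
rewrite -(respread_T Dv) -(respread_T Dw) /pierce_T !respread_digit1// -e.
rewrite !sparse_shiftE -e; have := hm _ mv; move: k4 mv; set k := K v => k4 mk hk.
have -> : 1 - k * v / 4 - (1 - k * w / 4) = - (k / 4 * (v - w)) by field.
have -> : 1 - k * respread v - (1 - k * respread w) =
  - (k * (respread v - respread w)) by ring.
rewrite !normrN !normrM normfV !(@ger0_norm _ k) ?(@ger0_norm _ 4); [|lra..].
rewrite powRM//; last lra.
have := powR_ge0 `|respread v - respread w| s.
move: (`|respread v - respread w| `^ s) => t t0 h.
have p0 : 0 <= (2^-1 : R) ^+ n by rewrite exprn_ge0.
rewrite exprS.
suff : k / 4 * `|v - w| <= k / 4 * (11 * t + 2^-1 * 2^-1 ^+ n).
  by rewrite ler_pM2l//; lra.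
apply: (le_trans h); move: hk p0.
move: (k `^ s) ((2^-1 : R) ^+ n) => ks p hk p0.
by nra.
Qed.

End sparse.

(** * Hausdorff measure and dimension *)

Section hausdorff_facts.
Context {R : realType}.
Implicit Types (s C : R) (A E U : set R).

Lemma diam_pow_ge0 s U : (0 <= diam_pow s U)%E.
Proof. by rewrite /diam_pow; case: ifP => // _; exact: poweR_ge0. Qed.

Lemma le_dist_diam U x y : U x -> U y -> (`|x - y|%:E <= diam U)%E.
Proof. by move=> Ux Uy; apply: ereal_sup_ubound; exists x, y. Qed.

Lemma dist_powR_le_diam_pow s U x y : 0 <= s -> U x -> U y ->
  ((`|x - y| `^ s)%:E <= diam_pow s U)%E.
Proof.
move=> s0 Ux Uy; rewrite /diam_pow ifF; last first.
  by apply/eqP => U0; rewrite U0 in Ux.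
have h := le_dist_diam Ux Uy.
have h0 : (0 <= `|x - y|%:E)%E by rewrite lee_fin.
rewrite -poweR_EFin gt0_ler_poweR// ?in_itv/= ?h0 ?leey//.
by rewrite (le_trans h0 h).
Qed.

Lemma diam_pow_le s U (d : R) : 0 <= s -> 0 <= d ->
  (forall x y, U x -> U y -> `|x - y| <= d) -> (diam_pow s U <= (d `^ s)%:E)%E.
Proof.
move=> s0 d0 Ud; rewrite /diam_pow; case: ifPn => [_|/set0P[x Ux]].
  by rewrite lee_fin powR_ge0.
have dU : (diam U <= d%:E)%E.
  by apply: ge_ereal_sup => _ [y [z [Uy Uz ->]]]; rewrite lee_fin Ud.
have U0 : (0 <= diam U)%E.
  by apply: le_trans (le_dist_diam Ux Ux); rewrite lee_fin.
by rewrite -poweR_EFin gt0_ler_poweR// ?in_itv/= ?U0 ?lee_fin ?d0 ?leey.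
Qed.

(** A form of the mass distribution principle: the mass of a set is the Lebesgue
measure of its preimage under g, and the Hoelder bound says that a set U has mass
at most a constant times |U|^s. *)
Lemma hausdorff_measure_neq0 s C A E (g : R -> R) :
  0 <= s -> 0 < C -> measurable A -> (0 < lebesgue_measure A)%E ->
  (forall v, A v -> E (g v)) ->
  (forall v w, A v -> A w -> `|v - w| <= C * `|g v - g w| `^ s) ->
  hausdorff_measure s E <> 0%E.
Proof.
move=> s0 C0 mA A0 AE hold HE0.
suff : (lebesgue_measure A <= 0)%E by apply/negP; rewrite -ltNge.
apply/lee_addgt0Pr => e e0; rewrite add0e.
have : (hausdorff_premeasure s 1 E < (e / (2 * C))%:E)%E.
  apply: (@le_lt_trans _ _ 0%E); last by rewrite lte_fin divr_gt0 ?mulr_gt0.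
  by rewrite -HE0; apply: ereal_sup_ubound; exists 1 => //=; rewrite ltr01.
move=> /ereal_inf_lt[_ [U [EU U1] <-]] sumU.
have Ufin i : diam_pow s (U i) \is a fin_num.
  rewrite /diam_pow; case: ifP => // _; rewrite ge0_fin_numE ?poweR_ge0//.
  by apply: poweR_lty; apply: le_lt_trans (U1 i) _; rewrite ltry.
pose r i := C * fine (diam_pow s (U i)).
have r0 i : 0 <= r i by rewrite mulr_ge0 ?fine_ge0 ?diam_pow_ge0// ltW.
(* When g^-1 (U i) misses A the center c i is a default value, and the interval
   around it is harmless. *)
pose c i : R := get [set v | A v /\ U i (g v)].
pose B i : set R := `[c i - r i, c i + r i]%classic.
have Acov : A `<=` \bigcup_i B i.
  move=> v Av; have [i _ Ui] := EU _ (AE _ Av); exists i => //.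
  have [Ac Uc] : A (c i) /\ U i (g (c i)).
    by apply: (@getPex _ [set v | A v /\ U i (g v)]); exists v.
  rewrite /B /= in_itv/= -ler_distl; apply: (le_trans (hold _ _ Av Ac)).
  rewrite ler_pM2l// -lee_fin fineK//.
  exact: dist_powR_le_diam_pow.
apply: (@le_trans _ _ (\sum_(0 <= i <oo) lebesgue_measure (B i))%E).
  by apply: measure_sigma_subadditive => // i; exact: measurable_itv.
apply: (@le_trans _ _ (\sum_(0 <= i <oo) (2 * C)%:E * diam_pow s (U i))%E).
  apply: lee_nneseries => // i _; rewrite /B lebesgue_measure_itv/=.
  case: ifP => _; last by rewrite mule_ge0 ?diam_pow_ge0// lee_fin mulr_ge0// ltW.
  rewrite -(fineK (Ufin i)) -EFinM -EFinD lee_fin /r.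
  by move: (fine _) => t; lra.
rewrite nneseriesZl; last by move=> i _; exact: diam_pow_ge0.
rewrite muleC -lee_pdivlMr ?mulr_gt0//.
exact: ltW.
Qed.

(** N intervals of length 1/N have total weight N^{1-s}, which tends to 0. *)
Lemma hausdorff_measure_eq0 s E : 1 < s ->
  E `<=` [set x | 0 < x <= 1] -> hausdorff_measure s E = 0%E.
Proof.
move=> s1 E01; have s0 : 0 <= s by lra.
have H0 delta : (0 <= hausdorff_premeasure s delta E)%E.
  apply: le_ereal_inf_tmp => _ [U _ <-].
  by apply: nneseries_ge0 => i _ _; exact: diam_pow_ge0.
apply/eqP; rewrite eq_le; apply/andP; split; last first.
  by apply: le_trans (H0 1) _; apply: ereal_sup_ubound; exists 1 => //=; rewrite ltr01.
apply: ge_ereal_sup => _ [delta /= delta0 <-].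
apply/lee_addgt0Pr => e e0; rewrite add0e.
have [n [nd ne]] : exists n : nat, n.+1%:R^-1 <= delta /\
    (n.+1%:R^-1 `^ s) *+ n.+2 <= e.
  pose X : R := Num.max delta^-1 ((2 / e) `^ (s - 1)^-1).
  exists (Num.truncn X).
  have X0 : 0 <= X by rewrite le_max invr_ge0 ltW.
  have /andP[_] := truncn_itv X0; set n := Num.truncn X => /ltW.
  rewrite ge_max => /andP[nd ne].
  have N0 : 0 < n.+1%:R :> R by rewrite ltr0n.
  split; first by rewrite -[leRHS]invrK lef_pV2 ?posrE ?invr_gt0.
  rewrite -mulr_natr -powR_inv1 // -powRrM mulN1r powRN mulrC ler_pdivrMr ?powR_gt0//.
  have h : 2 / e <= n.+1%:R `^ (s - 1).
    have -> : 2 / e = ((2 / e) `^ (s - 1)^-1) `^ (s - 1).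
      by rewrite -powRrM mulVf ?powRr1 ?divr_ge0 ?ltW//; lra.
    by apply: ge0_ler_powR; rewrite ?nnegrE ?powR_ge0//; lra.
  rewrite -[s](subrK 1) powRD ?powRr1 ?ler0n//; last by rewrite (gt_eqF N0) implybT.
  rewrite mulrA; apply: (@le_trans _ _ (2 * n.+1%:R)).
    by rewrite -natrM ler_nat mul2n -addnn addSnnS leq_addl.
  by rewrite ler_pM2r// -ler_pdivrMl// mulrC.
pose N := n.+1%:R : R.
have N0 : 0 < N by rewrite ltr0n.
(* One interval more than N, because x = 1 falls in the interval of index N. *)
pose U i := if (i < n.+2)%N then `[i%:R / N, i.+1%:R / N]%classic else set0 : set R.
have Ud i x y : U i x -> U i y -> `|x - y| <= N^-1.
  rewrite /U; case: ifP => // _; rewrite /= !in_itv/= -natr1 mulrDl mul1r.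
  move: N^-1 => q.
  by move=> /andP[x1 x2] /andP[y1 y2]; rewrite ler_norml; lra.
apply: ge_ereal_inf; exists (\sum_(0 <= i <oo) diam_pow s (U i))%E.
  exists U => //; split; last first.
    move=> i; apply: ge_ereal_sup => _ [x [y [Ux Uy ->]]].
    by rewrite lee_fin (le_trans (Ud _ _ _ Ux Uy)).
  move=> x /E01/andP[x0 x1]; exists (Num.truncn (x * N)) => //.
  have xN : 0 <= x * N by rewrite mulr_ge0 ?ltW.
  have /andP[t1 t2] := truncn_itv xN.
  rewrite /U ifT; last first.
    rewrite -(ltr_nat R) (le_lt_trans t1)//.
    apply: (@le_lt_trans _ _ N); first by rewrite ler_piMl// ltW.
    by rewrite ltr_nat.
  by rewrite /= in_itv/= ler_pdivrMr// t1 ler_pdivlMr// ltW.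
apply: (@le_trans _ _ (\sum_(0 <= i < n.+2) (N^-1 `^ s)%:E)%E).
  rewrite (nneseries_split 0 n.+2); last by move=> i _; exact: diam_pow_ge0.
  rewrite add0n eseries0 ?adde0; last first.
    by move=> i ni _; rewrite /U ltnNge ni /= /diam_pow eqxx.
  apply: lee_sum => i _; apply: diam_pow_le => //; first by rewrite invr_ge0 ltW.
  exact: Ud.
by rewrite sumEFin lee_fin sumr_const_nat subn0.
Qed.

Lemma hausdorff_dim_le1 E : E `<=` [set x | 0 < x <= 1] ->
  (hausdorff_dim E <= 1)%E.
Proof.
move=> E01; apply/lee_addgt0Pr => e e0; apply: ereal_inf_lbound.
exists (1 + e) => //; split; first by rewrite addr_ge0// ltW.
by apply: hausdorff_measure_eq0 => //; rewrite ltrDl.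
Qed.

End hausdorff_facts.

Lemma expR1_lt4 (R : realType) : expR 1 < 4 :> R.
Proof.
(* e^{-1/2} > 1 - 1/2, squared. *)
have h : 1 / 2 < expR (- (1 / 2)) :> R.
  have /expR_gt1Dx : - (1 / 2) != 0 :> R by rewrite lt_eqF//; lra.
  by lra.
have h2 : 1 / 4 < expR (-1) :> R.
  have -> : (-1 : R) = - (1 / 2) + - (1 / 2) by lra.
  by rewrite expRD; nra.
have -> : expR 1 = (expR (-1))^-1 :> R by rewrite expRN invrK.
by rewrite invf_plt ?posrE ?expR_gt0// -div1r.
Qed.

(** * The set of points with fast growing digits *)

Section fast_digits.
Context {R : realType}.

Lemma respread_not_cvg (v : R) : unit_irrat v ->
  ~ ((((pierce_digit n (respread v))%:~R : R) `^ (1 / n%:R)) @[n --> \oo] --> expR 1).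
Proof.
move=> Dv cv.
have ge4 n : 4 <= ((pierce_digit n.+1 (respread v))%:~R : R) `^ (1 / n.+1%:R).
  have -> : (4 : R) = (4 ^+ n.+1) `^ (1 / n.+1%:R).
    by rewrite -powR_mulrn// -powRrM mul1r divff// powRr1.
  have digit_ge := respread_digit_ge n Dv.
  apply: ge0_ler_powR; rewrite ?nnegrE ?divr_ge0 ?exprn_ge0//.
  exact: le_trans digit_ge.
suff : (4 : R) <= expR 1 by rewrite leNgt expR1_lt4.
rewrite -(cvg_lim _ cv)//; apply: limr_ge; first by apply/cvg_ex; exists (expR 1).
near=> n; have n0 : (0 < n)%N by near: n; exact: nbhs_infty_gt.
by rewrite -(prednK n0); exact: ge4.
Unshelve. all: by end_near. Qed.

Lemma measurable_rational : measurable (@rational R).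
Proof.
apply: countable_measurable => [x|]; first exact: measurable_set1.
apply: card_le_trans (card_image_le _ _) _; exact: countableP.
Qed.

(** For s < 1, [respread_holder] applies to the digits at least
m = 8 + 4^{1/(1-s)}, for then k^{1-s} >= 4.  All the irrational v below
4 / (m + 1) have such a first digit, and they form a set of positive Lebesgue
measure. *)
Lemma hausdorff_dim_ge1 (E : set R) :
  (forall v, unit_irrat v -> E (respread v)) -> (1 <= hausdorff_dim E)%E.
Proof.
move=> DE; apply: le_ereal_inf_tmp => _ [s [s0 Hs] <-].
rewrite lee_fin leNgt; apply/negP => s1; move: Hs.
pose m : R := 8 + 4 `^ (1 - s)^-1.
have m8 : 8 <= m by rewrite lerDl powR_ge0.
pose e := 4 / (m + 1).
have e0 : 0 < e by rewrite divr_gt0//; lra.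
have e1 : e < 1 by rewrite ltr_pdivrMr; lra.
pose A : set R := `]0, e[ `\` @rational R.
have mA : measurable A by apply: measurableD => //; exact: measurable_rational.
have AD v : A v -> unit_irrat v.
  by move=> [/=]; rewrite in_itv/= => /andP[v0 ve] vr; split => //; rewrite v0 (lt_trans ve).
have Am v : A v -> m <= (sparse_digit v)%:~R.
  move=> Av; have [/andP[v0 _] _] := AD _ Av; case: Av => /=.
  rewrite in_itv/= => /andP[_]; rewrite ltr_pdivlMr; last lra.
  have [_] := sparse_digit_bounds v0; move: (_%:~R) => k h1 h2 _.
  rewrite -(lerD2r 1) -(ler_pM2l v0); lra.
apply: (@hausdorff_measure_neq0 _ _ 11 A _ (@respread R)) => //.
- suff : (e%:E <= lebesgue_measure A)%E by apply: lt_le_trans; rewrite lte_fin.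
  have : (lebesgue_measure (`]0%R, e[ : set R) <=
      lebesgue_measure A + lebesgue_measure (@rational R))%E.
    apply: (@le_trans _ _ (lebesgue_measure (A `|` @rational R))); last first.
      by apply: measureU2 => //; exact: measurable_rational.
    apply: le_measure; rewrite ?inE//.
    - by apply: measurableU => //; exact: measurable_rational.
    - by move=> x xe; have [xr|xr] := pselect (rational x); [right|left].
  by rewrite lebesgue_measure_itv/= lte_fin e0 /rational lebesgue_measure_rat adde0 sube0.
- by move=> v /AD; exact: DE.
- move=> v w Av Aw; apply: (@respread_holder _ s m) => //;
    [by rewrite s0 ltW| |exact: AD|exact: AD|exact: Am|exact: Am].
  move=> k mk; have k0 : 0 < k by lra.
  have ks : 4 <= k `^ (1 - s).
    have {1}-> : (4 : R) = (4 `^ (1 - s)^-1) `^ (1 - s).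
      by rewrite -powRrM mulVf ?powRr1//; lra.
    by apply: ge0_ler_powR; rewrite ?nnegrE ?powR_ge0//; rewrite /m in mk; lra.
  have {2}-> : k = k `^ (1 - s) * k `^ s.
    rewrite -powRD ?subrK ?powRr1 ?ltW//.
    by rewrite gt_eqF// implybT.
  by rewrite ler_wpM2r ?powR_ge0.
Qed.

End fast_digits.

Theorem corollary1p4 (R : realType) :
  hausdorff_dim
    [set x : R | [/\ 0 < x <= 1, irrational x &
       ~ (((pierce_digit n x)%:~R : R) `^ (1 / n%:R) @[n --> \oo] --> expR 1)]]
  = 1%E.
Proof.
apply/eqP; rewrite eq_le; apply/andP; split.
  by apply: hausdorff_dim_le1 => x [].
apply: hausdorff_dim_ge1 => v Dv; split.
- by rewrite respread_gt0//; have /andP[] := respread_itv Dv.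
- exact: respread_irrational.
- exact: respread_not_cvg.
Qed.
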